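(* Consider the linear time-invariant closed-loop system described in the context, with any one of the three controllers (a), (b), (c), and the associated polynomials $P_0(s)$ (of degree $n$) and $Q(s)$ (of degree $m$). If $P_0(s)$ and $Q(s)$ have all of their roots in the open left-half plane $\{s\in\mathbb C:\operatorname{Re}s<0\}$, then the closed-loop system is $\alpha$-stable.
   Context: Plant: $\dot x(t)=Ax(t)+Bu(t)$, $y(t)=Cx(t)$, with $A\in\mathbb R^{n\times n}$ nonsingular, $B\in\mathbb R^{n\times m}$, $C\in\mathbb R^{m\times n}$. Fix $T>0$, put $M:=CA^{-1}(e^{AT}-I)B\in\mathbb R^{m\times m}$, assumed nonsingular, and let the output predictor be $\hat y(t+T)=g(x(t),u(t)):=Ce^{AT}x(t)+Mu(t)$. Controllers, with parameter $\alpha>0$ and reference input $r(t)\in\mathbb R^m$, $r$ continuous and piecewise continuously differentiable: (a) $\dot u(t)=\alpha M^{-1}\big(r(t+T)-g(x(t),u(t))\big)$; (b) $\dot u(t)=M^{-1}\big(\alpha(r(t+T)-g(x(t),u(t)))+\dot r(t+T)-Ce^{AT}(Ax(t)+Bu(t))\big)$; (c) $\dot u(t)=M^{-1}\big(\alpha(r(t+T)-g(x(t),u(t)))-Ce^{AT}(Ax(t)+Bu(t))\big)$. The closed-loop system is viewed as a linear system with augmented state $z(t)=(x(t)^\top,u(t)^\top)^\top\in\mathbb R^{n+m}$ and system matrix $\Phi_\alpha\in\mathbb R^{(n+m)\times(n+m)}$ (the coefficient matrix of $z$ in $\dot z$). For controller (a), $$\Phi_\alpha=\begin{pmatrix}A&B\\-\alpha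 M^{-1}Ce^{AT}&-\alpha I\end{pmatrix},$$ and for (b) and (c) the lower blocks are $-M^{-1}(\alpha Ce^{AT}+Ce^{AT}A)$ and $-\alpha I-M^{-1}Ce^{AT}B$. Polynomials. $P_\alpha(s):=\det(sI-\Phi_\alpha)$ can be written as $P_\alpha(s)=\sum_{i=0}^m\alpha^iP_{m-i}(s)$ with polynomials $P_i(s)=\sum_{j=0}^{n+i}a_{i,j}s^j$, $i=0,\dots,m$, that do not depend on $\alpha$. It is assumed that $a_{i,n+i}\ne0$ for all $i$ (so $\deg P_i=n+i$) and $a_{m,n+m}=1$. In particular $P_0(s)$ is the coefficient of $\alpha^m$. Define $Q(s):=\sum_{i=0}^m a_{m-i,n+m-i}\,s^{m-i}$. $\alpha$-stability. Let $\Gamma\subset\mathbb R^{n+m}$ be a given compact set of allowed initial states. The closed-loop system is $\alpha$-stable if there exist $\bar\alpha\ge0$ and three class-$\mathcal K$ functions $\beta,\gamma_1,\gamma_2$ (independent of $\alpha$) such that for every initial state $z(0)\in\Gamma$, every input $\{r(t)\}$, and every $\alpha\ge\bar\alpha$, $$\|z(t)\|\le\beta(\|z(0)\|)+\gamma_1(\|r\|_\infty)+\gamma_2(\|\dot r\|_\infty)\quad\text{for all }t\ge0,$$ where $\|r\|_\infty$, $\|\dot r\|_\infty$ are the $L^\infty$ norms of $\{r(t)\}$ and $\{\dot r(t)\}$. *)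

(* Defs.v *)
From HB Require Import structures.
From mathcomp Require Import all_boot all_order all_algebra.
From mathcomp Require Import complex.
From mathcomp Require Import all_classical all_reals all_analysis.
From mathcomp Require Import ring.

Set Implicit Arguments.
Unset Strict Implicit.
Unset Printing Implicit Defensive.

Import Order.TTheory GRing.Theory Num.Theory.
Import numFieldNormedType.Exports.

Local Open Scope classical_set_scope.
Local Open Scope ring_scope.

(* The library norm `|v| on matrices is the max norm. *)
Definition enorm {R : realType} {k : nat} (v : 'cV[R]_k) : R :=
  Num.sqrt (\sum_(i < k) v i 0 ^+ 2).

Definition expmx {R : realType} {k : nat} (X : 'M[R]_k) : 'M[R]_k :=
  limn (series (fun j => (j`!)%:R^-1 *: X ^+ j)).

Definition pred_gain {R : realType} {n m : nat} (A : 'M[R]_n)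
    (B : 'M[R]_(n, m)) (C : 'M[R]_(m, n)) (T : R) : 'M[R]_m :=
  C *m invmx A *m (expmx (T *: A) - 1%:M) *m B.

Definition predictor {R : realType} {n m : nat} (A : 'M[R]_n)
    (B : 'M[R]_(n, m)) (C : 'M[R]_(m, n)) (T : R)
    (x : 'cV[R]_n) (u : 'cV[R]_m) : 'cV[R]_m :=
  C *m expmx (T *: A) *m x + pred_gain A B C T *m u.

Variant controller := ControllerA | ControllerB | ControllerC.

(* [rT] and [drT] stand for r(t+T) and r'(t+T). *)
Definition udot {R : realType} {n m : nat} (A : 'M[R]_n)
    (B : 'M[R]_(n, m)) (C : 'M[R]_(m, n)) (T : R) (c : controller) (alpha : R)
    (x : 'cV[R]_n) (u rT drT : 'cV[R]_m) : 'cV[R]_m :=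
  let M := pred_gain A B C T in
  let err := rT - predictor A B C T x u in
  let drift := C *m expmx (T *: A) *m (A *m x + B *m u) in
  match c with
  | ControllerA => alpha *: (invmx M *m err)
  | ControllerB => invmx M *m (alpha *: err + drT - drift)
  | ControllerC => invmx M *m (alpha *: err - drift)
  end.

Definition system_matrix {R : realType} {n m : nat} (A : 'M[R]_n)
    (B : 'M[R]_(n, m)) (C : 'M[R]_(m, n)) (T : R) (c : controller) (alpha : R) :
    'M[R]_(n + m) :=
  let Minv := invmx (pred_gain A B C T) in
  let CE := C *m expmx (T *: A) in
  match c with
  | ControllerA =>
      block_mx A B (- (alpha *: (Minv *m CE))) (- alpha%:M)
  | ControllerB | ControllerC =>
      block_mx A B (- (Minv *m (alpha *: CE + CE *m A)))
                   (- alpha%:M - Minv *m CE *m B)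
  end.

Definition controller_input {R : realType} {n m : nat} (A : 'M[R]_n)
    (B : 'M[R]_(n, m)) (C : 'M[R]_(m, n)) (T : R) (c : controller) (alpha : R)
    (rT drT : 'cV[R]_m) : 'cV[R]_m :=
  invmx (pred_gain A B C T) *m
    (alpha *: rT + (if c is ControllerB then drT else 0)).

Lemma closed_loop_affine (R : realType) (n m : nat) (A : 'M[R]_n)
    (B : 'M[R]_(n, m)) (C : 'M[R]_(m, n)) (T : R) (c : controller) (alpha : R)
    (x : 'cV[R]_n) (u rT drT : 'cV[R]_m) :
  pred_gain A B C T \in unitmx ->
  col_mx (A *m x + B *m u) (udot A B C T c alpha x u rT drT) =
  system_matrix A B C T c alpha *m col_mx x u
  + col_mx 0 (controller_input A B C T c alpha rT drT).
Proof.
move=> Mu; rewrite /system_matrix /controller_input /udot /predictor.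
set M := pred_gain A B C T in Mu *;
move: (C *m expmx _) => E.
have eu (v : 'cV[R]_m) : invmx M *m (M *m v) = v by rewrite mulKmx.
case: c; rewrite mul_block_col add_col_mx addr0; congr col_mx.
- rewrite addr0 !(mulmxDr, mulmxN, mulNmx) mul_scalar_mx -!scalemxAr.
  rewrite -!scalemxAl eu -!mulmxA.
  move: (invmx M *m rT) (invmx M *m (E *m x)) => a b.
  by apply/colP => i; rewrite !mxE; ring.
- rewrite !(mulmxDr, mulmxN, mulNmx, mulmxDl).
  rewrite mul_scalar_mx -!scalemxAr -!scalemxAl.
  rewrite !(mulmxDr, mulmxN, mulNmx, mulmxDl) eu -!mulmxA.
  move: (invmx M *m rT) (invmx M *m drT) (invmx M *m (E *m x)).
  move: (invmx M *m (E *m (A *m x))) (invmx M *m (E *m (B *m u))) => a b c d e.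
  by apply/colP => i; rewrite !mxE; ring.
- rewrite addr0 !(mulmxDr, mulmxN, mulNmx, mulmxDl).
  rewrite mul_scalar_mx -!scalemxAr -!scalemxAl.
  rewrite !(mulmxDr, mulmxN, mulNmx, mulmxDl) eu -!mulmxA.
  move: (invmx M *m rT) (invmx M *m (E *m x)).
  move: (invmx M *m (E *m (A *m x))) (invmx M *m (E *m (B *m u))) => a b c d.
  by apply/colP => i; rewrite !mxE; ring.
Qed.

(* Breakpoints of a piecewise object on [0, +oo[. *)
Definition locally_finite {R : realType} (S : set R) : Prop :=
  forall b : R, finite_set (S `&` `[0, b]).

Definition piecewise_C1 {R : realType} {m : nat} (r : R -> 'cV[R]_m) : Prop :=
  exists S : set R, [/\ locally_finite S,
    forall t : R, 0 < t -> ~ S t -> derivable r t 1 /\ {for t, continuous (derive1 r)},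
    forall t : R, 0 <= t -> cvg (derive1 r s @[s --> t^'+]) &
    forall t : R, 0 < t -> cvg (derive1 r s @[s --> t^'-])].

Definition admissible_input {R : realType} {m : nat} (r : R -> 'cV[R]_m) :
    Prop :=
  {within `[0, +oo[, continuous r} /\ piecewise_C1 r.

(* For ControllerB the right-hand side may jump with r', so the differential
   equation is imposed off a locally finite set of times. *)
Definition closed_loop_trajectory {R : realType} {n m : nat} (A : 'M[R]_n)
    (B : 'M[R]_(n, m)) (C : 'M[R]_(m, n)) (T : R) (c : controller) (alpha : R)
    (r : R -> 'cV[R]_m) (x : R -> 'cV[R]_n) (u : R -> 'cV[R]_m) : Prop :=
  [/\ {within `[0, +oo[, continuous x},
      {within `[0, +oo[, continuous u} &
      exists S : set R, locally_finite S /\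
        forall t : R, 0 < t -> ~ S t ->
          is_derive t 1 x (A *m x t + B *m u t) /\
          is_derive t 1 u
            (udot A B C T c alpha (x t) (u t) (r (t + T)) ((derive1 r) (t + T)))].

Definition class_K {R : realType} (f : R -> R) : Prop :=
  [/\ f 0 = 0, {within `[0, +oo[, continuous f} &
      {in `[0, +oo[ &, {homo f : s t / s < t}}].

(* L^oo norm on the time axis [0, +oo[: [\_] extends by 0 off it. *)
Definition Linfty_norm {R : realType} {m : nat} (f : R -> 'cV[R]_m) : \bar R :=
  Lnorm lebesgue_measure +oo%E
    ((fun t => (enorm (f t))%:E) \_ (`[0%R, +oo[ : set R)).

(* [er_map g] extends g to \bar R by +oo |-> +oo, so that the bound is void when
   an input norm is infinite. *)
Definition alpha_stable {R : realType} {n m : nat} (A : 'M[R]_n)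
    (B : 'M[R]_(n, m)) (C : 'M[R]_(m, n)) (T : R) (c : controller)
    (Gamma : set 'cV[R]_(n + m)) : Prop :=
  exists alpha0 : R, 0 <= alpha0 /\
  exists beta gamma1 gamma2 : R -> R,
    [/\ class_K beta, class_K gamma1, class_K gamma2 &
    forall (r : R -> 'cV[R]_m) (alpha : R)
           (x : R -> 'cV[R]_n) (u : R -> 'cV[R]_m),
      let z t := col_mx (x t) (u t) in
      admissible_input r -> 0 < alpha -> alpha0 <= alpha ->
      closed_loop_trajectory A B C T c alpha r x u ->
      Gamma (z 0) ->
      forall t : R, 0 <= t ->
        ((enorm (z t))%:E <= (beta (enorm (z 0)))%:E
           + er_map gamma1 (Linfty_norm r)
           + er_map gamma2 (Linfty_norm (derive1 r)))%E].

(* The identity for all alpha > 0 determines P 0, ..., P m uniquely. *)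
Definition alpha_expansion {R : realType} {n m : nat}
    (Phi : R -> 'M[R]_(n + m)) (P : nat -> {poly R}) : Prop :=
  forall alpha : R, 0 < alpha ->
    char_poly (Phi alpha) = \sum_(i < m.+1) alpha ^+ i *: P (m - i)%N.

Definition Qpoly {R : realType} (n m : nat) (P : nat -> {poly R}) : {poly R} :=
  \sum_(i < m.+1) (P (m - i)%N)`_(n + m - i) *: 'X^(m - i).

Definition hurwitz {R : realType} (p : {poly R}) : Prop :=
  forall s : R[i], root (map_poly (real_complex R) p) s -> complex.Re s < 0.

(* Main.v *)
(* In the coordinates [x] and [v = u + K x], where [K = M^-1 C e^(AT)] so that
   [v] is [M^-1] times the predicted output, all three loops become
     x' = F x + B v,   v' = - alpha v + D x + E v + (forcing),   F = A - B K,
   with [D], [E] independent of [alpha] and a forcing of size O(alpha).  Letting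
   alpha -> oo in the characteristic polynomial gives [P 0 = char_poly F], so [F]
   is Hurwitz; hence [x] is bounded by its initial value and by sup |v| (componentwise
   in a complex triangular form of [F]).  The [v]-equation damps at rate [alpha], so
   the coupling through [D] and [E] has gain O(1 / alpha) and a small-gain argument
   on each [0, b] closes the estimate uniformly in large [alpha]. *)

Require Import Defs.
From HB Require Import structures.
From mathcomp Require Import all_boot all_order all_algebra.
From mathcomp Require Import complex spectral.
From mathcomp Require Import all_classical all_reals all_analysis ess_sup_inf.
From mathcomp Require Import ring lra.

Set Implicit Arguments.
Unset Strict Implicit.
Unset Printing Implicit Defensive.

Import Order.TTheory GRing.Theory Num.Theory.
Import numFieldNormedType.Exports.

Local Open Scope classical_set_scope.
Local Open Scope ring_scope.

(** * Scalar functions with a prescribed derivative off exceptional times *)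

(** No integral is taken: a solution is a continuous function with known derivative off [S], and
    estimates come from monotonicity. *)
Definition antiderivative_on {R : realType} (b : R) (S : set R) (f df : R -> R) :
    Prop :=
  {within `[0, b], continuous f} /\
  forall s, 0 < s < b -> ~ S s -> is_derive s 1 f (df s).

(** Induction on the list of exceptional points: one inside []a, b[] splits the interval, one
    outside is dropped. With none left, this is the usual derivative criterion. *)
Lemma nincr_off_finite {R : realType} (f df : R -> R) (S : set R) (a b : R) :
  finite_set S -> a <= b -> {within `[a, b], continuous f} ->
  (forall s, a < s < b -> ~ S s -> is_derive s 1 f (df s) /\ df s <= 0) ->
  f b <= f a.
Proof.
move=> /finite_seqP[l ->]; elim: l a b => [|h l IH] a b ab fc fd.
  apply: (@ler0_derive1_le_cc _ f a b) => //; rewrite ?in_itv/= ?lexx ?ab//.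
  - by move=> x; rewrite in_itv/= => /fd[]// [].
  - by move=> x; rewrite in_itv/= => /fd[]// d d0; rewrite derive1E derive_val.
have [/andP[ah hb]|hab] := boolP (a < h < b).
  apply: (@le_trans _ _ (f h)).
    apply: IH (ltW hb) _ _.
      apply: continuous_subspaceW fc; apply: subset_itvr.
      by rewrite bnd_simp ltW.
    move=> s /andP[hs sb] sl; apply: fd; first by rewrite (lt_trans ah).
    by rewrite /= inE (gt_eqF hs).
  apply: IH (ltW ah) _ _.
    apply: continuous_subspaceW fc; apply: subset_itvl.
    by rewrite bnd_simp ltW.
  move=> s /andP[as_ sh] sl; apply: fd; first by rewrite as_ (lt_trans sh).
  by rewrite /= inE (lt_eqF sh).
apply: IH => // s sab sl; apply: fd => //=; rewrite inE => /orP[/eqP sh|//].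
by move: hab; rewrite -sh sab.
Qed.

Lemma antiderivative_onD {R : realType} (b : R) (S : set R) (f df g dg : R -> R) :
  antiderivative_on b S f df -> antiderivative_on b S g dg ->
  antiderivative_on b S (fun s => f s + g s) (fun s => df s + dg s).
Proof.
move=> [fc fd] [gc gd]; split; first exact: within_continuousD.
by move=> s sb sS; apply: is_deriveD; [exact: fd|exact: gd].
Qed.

Lemma antiderivative_onM {R : realType} (b : R) (S : set R) (f df g dg : R -> R) :
  antiderivative_on b S f df -> antiderivative_on b S g dg ->
  antiderivative_on b S (fun s => f s * g s) (fun s => f s * dg s + g s * df s).
Proof.
move=> [fc fd] [gc gd]; split; first by move=> s; apply: cvgM; [exact: fc|exact: gc].
by move=> s sb sS; apply: is_deriveM; [exact: fd|exact: gd].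
Qed.

Lemma antiderivative_on_cst {R : realType} (b : R) (S : set R) (k : R) :
  antiderivative_on b S (fun=> k) (fun=> 0).
Proof.
split; first by move=> s; exact: cvg_cst.
by move=> s _ _; exact: is_derive_cst.
Qed.

Lemma antiderivative_on_expR {R : realType} (b : R) (S : set R) (k : R) :
  antiderivative_on b S (fun s => expR (k * s)) (fun s => k * expR (k * s)).
Proof.
have d s : is_derive s (1 : R) (fun s => expR (k * s)) (k * expR (k * s)).
  have ds : is_derive s 1 (fun x : R => k * x) k.
    change (is_derive s 1 (k \*: (id : R -> R)) k).
    by apply: is_derive_eq; rewrite /GRing.scale/= mulr1.
  by rewrite mulrC; exact: (is_derive1_comp (is_derive_expR (k * s)) ds).
split; last by [].
apply: continuous_subspaceT => s; apply: differentiable_continuous.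
by apply/derivable1_diffP; have [] := d s.
Qed.

Lemma eq_antiderivative_on {R : realType} (b : R) (S : set R) (f g df dg : R -> R) :
  f =1 g -> (forall s, 0 < s < b -> ~ S s -> df s = dg s) ->
  antiderivative_on b S f df -> antiderivative_on b S g dg.
Proof.
move=> /funext <- e [fc fd]; split=> // s sb sS.
by rewrite -e//; exact: fd.
Qed.

Lemma antiderivative_on_sum {R : realType} (b : R) (S : set R) (k : nat)
    (f df : 'I_k -> R -> R) :
  (forall i, antiderivative_on b S (f i) (df i)) ->
  antiderivative_on b S (fun s => \sum_i f i s) (fun s => \sum_i df i s).
Proof.
move=> fd.
have [+ +] : antiderivative_on b S (\sum_i f i) (\sum_i df i).
  elim/big_ind2 : _ => //; first exact: antiderivative_on_cst.
  by move=> *; exact: antiderivative_onD.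
by rewrite !fct_sumE; split.
Qed.

(* The weight [expR (mu * s)] turns [phi' <= - mu * phi + 2 * G ^+ 2 / mu], where
   [phi = a ^+ 2 + c ^+ 2], into a monotonicity statement. *)
Lemma damped_rotation_bound {R : realType} (b mu om Y G : R) (S : set R)
    (a c g h : R -> R) :
  finite_set S -> 0 < mu -> 0 <= G ->
  antiderivative_on b S a (fun s => - mu * a s - om * c s + g s) ->
  antiderivative_on b S c (fun s => om * a s - mu * c s + h s) ->
  `|a 0| <= Y -> `|c 0| <= Y ->
  (forall s, 0 < s < b -> ~ S s -> `|g s| <= G /\ `|h s| <= G) ->
  forall s, 0 <= s <= b -> `|a s| <= 2 * (Y + G / mu) /\ `|c s| <= 2 * (Y + G / mu).
Proof.
move=> fS mu0 G0 da dc a0 c0 gh s /andP[s0 sb].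
have Y0 : 0 <= Y by exact: le_trans a0.
have sq (x y : R) : `|x| <= y -> x ^+ 2 <= y ^+ 2.
  move=> xy; rewrite -[x ^+ 2]real_normK ?num_real// ler_sqr ?nnegrE//.
  exact: le_trans xy.
have [k [k0 Gk]] : exists k, 0 <= k /\ G = k * mu.
  by exists (G / mu); split; [rewrite divr_ge0// ltW|rewrite divfK// gt_eqF].
rewrite Gk mulfK ?gt_eqF//.
(* The energy is shifted by [2 * G ^+ 2 / mu ^+ 2], the equilibrium of the comparison inequality, so
   that [expR (mu * t) * phi t] is nonincreasing. The [om] terms cancel. *)
pose phi t := a t * a t + c t * c t - 2 * k ^+ 2.
have [pc pd] := antiderivative_onM (antiderivative_on_expR b S mu)
  (antiderivative_onD (antiderivative_onD (antiderivative_onM da da)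
     (antiderivative_onM dc dc))
     (antiderivative_on_cst b S (- (2 * k ^+ 2)))).
have : expR (mu * s) * phi s <= expR (mu * 0) * phi 0.
  eapply (@nincr_off_finite _ (fun t => expR (mu * t) * phi t) _ _ 0 s fS s0).
    apply: continuous_subspaceW pc; apply: subset_itvl; rewrite bnd_simp//.
  move=> t /andP[t0 ts] St; have tb : 0 < t < b by rewrite t0 (lt_le_trans ts).
  split; first exact: pd.
  move=> /=; set e := expR _; have e0 : 0 <= e by exact: expR_ge0.
  have [/sq g2 /sq h2] := gh _ tb St.
  have -> : forall x y : R, e * x + y * (mu * e) = e * (x + y * mu).
    by move=> x y; ring.
  rewrite mulr_ge0_le0//.
  (* Times [mu], the left side is [g ^+ 2 + h ^+ 2 - 2 * G ^+ 2] minus the two squares introduced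
     next. *)
  rewrite -(pmulr_rle0 _ mu0).
  have : 0 <= (mu * a t - g t) ^+ 2 + (mu * c t - h t) ^+ 2 by rewrite addr_ge0 ?sqr_ge0.
  by rewrite Gk in g2 h2; nra.
rewrite mulr0 expR0 mul1r => le0.
have : phi s <= a 0 * a 0 + c 0 * c 0.
  have [phi0|phi0] := leP (phi s) 0.
    by rewrite (le_trans phi0)// addr_ge0 -?expr2 ?sqr_ge0.
  have : phi s <= expR (mu * s) * phi s.
    apply: ler_peMl; first exact: ltW.
    by rewrite -[leLHS]expR0 ler_expR mulr_ge0// ltW.
  move=> /le_trans /(_ le0) /le_trans; apply; rewrite /phi lerBlDr lerDl.
  by rewrite mulr_ge0// sqr_ge0.
have := sq _ _ a0; have := sq _ _ c0.
rewrite /phi => c2 a2 le1.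
have fin (x : R) : x ^+ 2 <= a s * a s + c s * c s -> `|x| <= 2 * (Y + k).
  move=> xs; rewrite -ler_sqr ?nnegrE ?mulr_ge0 ?addr_ge0//.
  rewrite real_normK ?num_real//.
  by have := mulr_ge0 Y0 k0; nra.
by split; apply: fin; rewrite -expr2 ?lerDl ?lerDr -?expr2 sqr_ge0.
Qed.

(** * Vector-valued solutions and max-norm estimates *)

Definition coord_antiderivative_on {R : realType} {k : nat} (b : R) (S : set R)
    (x dx : R -> 'cV[R]_k) : Prop :=
  forall i, antiderivative_on b S (fun s => x s i 0) (fun s => dx s i 0).

(** A crude bound for the operator norm of [K] relative to the max norm. *)
Definition entry_sum {R : realType} {p k : nat} (K : 'M[R]_(p, k)) : R :=
  \sum_i \sum_j `|K i j|.

Lemma entry_sum_ge0 {R : realType} {p k : nat} (K : 'M[R]_(p, k)) :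
  0 <= entry_sum K.
Proof. by apply: sumr_ge0 => i _; exact: sumr_ge0. Qed.

Lemma entry_le_norm {R : realType} {p k : nat} (K : 'M[R]_(p, k)) i j :
  `|K i j| <= `|K|.
Proof.
rewrite [leRHS]/Num.Def.normr/= mx_normrE.
exact: (le_bigmax _ (fun ij => `|K ij.1 ij.2|) (i, j)).
Qed.

Lemma norm_le_entries {R : realType} {p : nat} (v : 'cV[R]_p) (e : R) :
  0 <= e -> (forall i, `|v i 0| <= e) -> `|v| <= e.
Proof.
move=> e0 ve; rewrite [leLHS]/Num.Def.normr/= mx_normrE.
by apply: bigmax_le => // -[i j] _ /=; rewrite (ord1 j).
Qed.

Lemma norm_mulmx_le {R : realType} {p k : nat} (K : 'M[R]_(p, k)) (x : 'cV[R]_k) :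
  `|K *m x| <= entry_sum K * `|x|.
Proof.
apply: norm_le_entries => [|i]; first by rewrite mulr_ge0 ?entry_sum_ge0.
rewrite !mxE (le_trans (ler_norm_sum _ _ _))//.
apply: (@le_trans _ _ ((\sum_j `|K i j|) * `|x|)).
  rewrite mulr_suml; apply: ler_sum => j _.
  by rewrite normrM ler_wpM2l// entry_le_norm.
rewrite ler_wpM2r// /entry_sum (bigD1 i)//= lerDl.
by apply: sumr_ge0 => j _; exact: sumr_ge0.
Qed.

Lemma coord_antiderivative_onMl {R : realType} {p k : nat} (K : 'M[R]_(p, k))
    (b : R) (S : set R) (x dx : R -> 'cV[R]_k) :
  coord_antiderivative_on b S x dx ->
  coord_antiderivative_on b S (fun s => K *m x s) (fun s => K *m dx s).
Proof.
move=> xd i.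
have := antiderivative_on_sum (fun j =>
  antiderivative_onM (antiderivative_on_cst b S (K i j)) (xd j)).
apply: eq_antiderivative_on => [s|s _ _]; rewrite !mxE//.
by apply: eq_bigr => j _; rewrite mulr0 addr0.
Qed.

Lemma coord_antiderivative_onD {R : realType} {k : nat}
    (b : R) (S : set R) (x dx y dy : R -> 'cV[R]_k) :
  coord_antiderivative_on b S x dx -> coord_antiderivative_on b S y dy ->
  coord_antiderivative_on b S (fun s => x s + y s) (fun s => dx s + dy s).
Proof.
move=> xd yd i; have := antiderivative_onD (xd i) (yd i).
by apply: eq_antiderivative_on => [s|s _ _]; rewrite !mxE.
Qed.

Lemma eq_coord_antiderivative_on {R : realType} {k : nat}
    (b : R) (S : set R) (x dx dy : R -> 'cV[R]_k) :
  (forall s, 0 < s < b -> ~ S s -> dx s = dy s) ->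
  coord_antiderivative_on b S x dx -> coord_antiderivative_on b S x dy.
Proof.
move=> e xd i; apply: eq_antiderivative_on (xd i) => // s sb sS.
by rewrite e.
Qed.

(** * Stable triangular systems *)

Lemma trig_mulmxE {R : realType} {k : nat} (L : 'M[R]_k) (x : 'cV[R]_k) i :
  is_trig_mx L ->
  (L *m x) i 0 = L i i * x i 0 + \sum_(j < k | (j < i)%N) L i j * x j 0.
Proof.
move=> /is_trig_mxP Lt; rewrite mxE (bigD1 i)//=; congr (_ + _).
rewrite (bigID (fun j : 'I_k => (j < i)%N))/= [X in _ + X]big1 => [|j /andP[ji]].
  rewrite addr0; apply: eq_bigl => j; case: ltnP; rewrite ?andbF// andbT => ji.
  by apply/eqP => jE; move: ji; rewrite jE ltnn.
rewrite -leqNgt => ij; rewrite Lt ?mul0r// ltn_neqAle ij andbT.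
by rewrite eq_sym val_eqE.
Qed.

(* Row [i] only sees the rows before it, so the bounds propagate downwards. *)
Lemma triangular_bound {R : realType} {n : nat} (Lr Li : 'M[R]_n) :
  is_trig_mx Lr -> is_trig_mx Li -> (forall i, Lr i i < 0) ->
  exists2 k, 0 <= k & forall b S (p q g h : R -> 'cV[R]_n) Y G,
    finite_set S -> 0 <= G ->
    coord_antiderivative_on b S p (fun s => Lr *m p s - Li *m q s + g s) ->
    coord_antiderivative_on b S q (fun s => Lr *m q s + Li *m p s + h s) ->
    `|p 0| <= Y -> `|q 0| <= Y ->
    (forall s, 0 < s < b -> ~ S s -> `|g s| <= G /\ `|h s| <= G) ->
    forall s, 0 <= s <= b -> `|p s| <= k * (Y + G) /\ `|q s| <= k * (Y + G).
Proof.
move=> Lrt Lit Lrn.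
(* Induction on the number [l] of leading rows already bounded; each new row enlarges the
   constant. *)
suff /(_ n)[k k0 kP] : forall l : nat, exists2 k, 0 <= k & forall b S
    (p q g h : R -> 'cV[R]_n) Y G,
    finite_set S -> 0 <= G ->
    coord_antiderivative_on b S p (fun s => Lr *m p s - Li *m q s + g s) ->
    coord_antiderivative_on b S q (fun s => Lr *m q s + Li *m p s + h s) ->
    `|p 0| <= Y -> `|q 0| <= Y ->
    (forall s, 0 < s < b -> ~ S s -> `|g s| <= G /\ `|h s| <= G) ->
    forall s, 0 <= s <= b -> forall i : 'I_n, (i < l)%N ->
    `|p s i 0| <= k * (Y + G) /\ `|q s i 0| <= k * (Y + G).
  exists k => // b S p q g h Y G fS G0 pd qd p0 q0 gh s sb.
  have Y0 : 0 <= Y by exact: le_trans p0.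
  have {}kP i := kP b S p q g h Y G fS G0 pd qd p0 q0 gh s sb i (ltn_ord i).
  by split; apply: norm_le_entries => [|i]; rewrite ?mulr_ge0 ?addr_ge0//;
    have [] := kP i.
elim=> [|l [k k0 IH]]; first by exists 0.
have [nl|ln] := leqP n l.
  exists k => // b S p q g h Y G fS G0 pd qd p0 q0 gh s sb i _.
  by apply: (IH b S p q g h Y G) => //; exact: leq_trans nl.
pose i := Ordinal ln; pose mu := - Lr i i.
have mu0 : 0 < mu by rewrite oppr_gt0.
pose tau := \sum_(j < n | (j < i)%N) (`|Lr i j| + `|Li i j|).
have tau0 : 0 <= tau by apply: sumr_ge0 => j _; rewrite addr_ge0.
(* The earlier rows contribute at most [tau * k * (Y + G)] and the forcing at most [G], so
   [k1 * (Y + G)] bounds the whole input to row [i]. *)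
pose k1 := 1 + tau * k.
have k10 : 0 <= k1 by rewrite addr_ge0// mulr_ge0.
have k1mu : 0 <= k1 / mu by rewrite divr_ge0// ltW.
have c0 : 0 <= 2 * (1 + k1 / mu) by rewrite mulr_ge0// addr_ge0.
exists (k + 2 * (1 + k1 / mu)); first by rewrite addr_ge0.
move=> b S p q g h Y G fS G0 pd qd p0 q0 gh s sb i'.
have Y0 : 0 <= Y by exact: le_trans p0.
have YG : 0 <= Y + G by rewrite addr_ge0.
rewrite ltnS leq_eqVlt => /predU1P[i'l|i'l]; last first.
  have [pk qk] := IH b S p q g h Y G fS G0 pd qd p0 q0 gh s sb _ i'l.
  by split; [apply: le_trans pk _|apply: le_trans qk _];
    rewrite ler_wpM2r// lerDl.
have {i' i'l}-> : i' = i by exact/val_inj.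
have sum_le (f1 f2 : 'cV[R]_n) :
    (forall j : 'I_n, (j < i)%N -> `|f1 j 0| <= k * (Y + G)) ->
    (forall j : 'I_n, (j < i)%N -> `|f2 j 0| <= k * (Y + G)) ->
    `|\sum_(j < n | (j < i)%N) Lr i j * f1 j 0|
      + `|\sum_(j < n | (j < i)%N) Li i j * f2 j 0| <= tau * k * (Y + G).
  move=> f1k f2k; rewrite -mulrA mulr_suml.
  under [leRHS]eq_bigr do rewrite mulrDl.
  rewrite big_split lerD// (le_trans (ler_norm_sum _ _ _))//;
    by apply: ler_sum => j ji; rewrite normrM ler_wpM2l//; auto.
(* Row [i] is a scalar complex equation split into real part [p] and imaginary part [q]: its
   diagonal coefficient has real part [- mu] and imaginary part [Li i i]. *)
have [||||||pk qk] := @damped_rotation_bound _ b mu (Li i i) Y (k1 * (Y + G)) S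
  (fun s => p s i 0) (fun s => q s i 0)
  (fun s => \sum_(j < n | (j < i)%N) Lr i j * p s j 0
            - \sum_(j < n | (j < i)%N) Li i j * q s j 0 + g s i 0)
  (fun s => \sum_(j < n | (j < i)%N) Lr i j * q s j 0
            + \sum_(j < n | (j < i)%N) Li i j * p s j 0 + h s i 0)
  fS mu0 _ _ _ _ _ _ s sb.
- by rewrite mulr_ge0.
- apply: eq_antiderivative_on (pd i) => // t _ _.
  have -> : (Lr *m p t - Li *m q t + g t) i 0 =
    (Lr *m p t) i 0 - (Li *m q t) i 0 + g t i 0 by rewrite !mxE.
  by rewrite !trig_mulmxE// /mu; ring.
- apply: eq_antiderivative_on (qd i) => // t _ _.
  have -> : (Lr *m q t + Li *m p t + h t) i 0 =
    (Lr *m q t) i 0 + (Li *m p t) i 0 + h t i 0 by rewrite !mxE.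
  by rewrite !trig_mulmxE// /mu; ring.
- exact: le_trans (entry_le_norm _ _ _) p0.
- exact: le_trans (entry_le_norm _ _ _) q0.
- move=> t tb tS.
  have tb' : 0 <= t <= b by case/andP: tb => *; rewrite !ltW.
  have pq := IH b S p q g h Y G fS G0 pd qd p0 q0 gh t tb'.
  have [gG hG] := gh t tb tS.
  have k1E : k1 * (Y + G) = tau * k * (Y + G) + (Y + G) by rewrite /k1; ring.
  have GYG : G <= Y + G by rewrite lerDr.
  split; rewrite k1E (le_trans (ler_normD _ _))// lerD//.
  + rewrite (le_trans (ler_normB _ _))//; apply: sum_le => j /pq; by case.
  + by rewrite (le_trans (entry_le_norm _ _ _))// (le_trans gG).
  + rewrite (le_trans (ler_normD _ _))//; apply: sum_le => j /pq; by case.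
  + by rewrite (le_trans (entry_le_norm _ _ _))// (le_trans hG).
have le_k : 2 * (Y + k1 * (Y + G) / mu) <= (k + 2 * (1 + k1 / mu)) * (Y + G).
  have -> : 2 * (Y + k1 * (Y + G) / mu) = 2 * Y + 2 * (k1 / mu) * (Y + G) by ring.
  by have := mulr_ge0 k0 YG; move: (k1 / mu) => z; nra.
by split; [exact: le_trans pk _|exact: le_trans qk _].
Qed.

(** * Complex triangular form of a real Hurwitz matrix *)

(** [U] intertwines [X - A] and [X - L]; in the determinants the nonzero constant [\det U]
    cancels. *)
Lemma char_poly_similar {K : fieldType} {n : nat} (U A L : 'M[K]_n) :
  U \in unitmx -> U *m A = L *m U -> char_poly A = char_poly L.
Proof.
move=> Uu UA; pose UP := map_mx (@polyC K) U.
have : \det UP * char_poly A = \det UP * char_poly L.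
  rewrite [RHS]mulrC -!det_mulmx; congr (\det _).
  by rewrite mulmxBr mulmxBl -!map_mxM UA scalar_mxC.
apply: mulfI; rewrite det_map_mx polyC_eq0.
by move: Uu; rewrite unitmxE unitfE.
Qed.

Lemma map_Re_mulmx {R : rcfType} {p k l : nat}
    (U : 'M[R[i]]_(p, k)) (V : 'M[R[i]]_(k, l)) :
  map_mx (@complex.Re R) (U *m V) =
  map_mx (@complex.Re R) U *m map_mx (@complex.Re R) V
  - map_mx (@complex.Im R) U *m map_mx (@complex.Im R) V.
Proof.
apply/matrixP => i j; rewrite !mxE.
rewrite (raddf_sum (@complex.Re R : Rcomplex R -> R)) -sumrB.
by apply: eq_bigr => a _; rewrite !mxE; case: (U i a) (V a j) => [? ?] [? ?].
Qed.

Lemma map_Im_mulmx {R : rcfType} {p k l : nat}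
    (U : 'M[R[i]]_(p, k)) (V : 'M[R[i]]_(k, l)) :
  map_mx (@complex.Im R) (U *m V) =
  map_mx (@complex.Re R) U *m map_mx (@complex.Im R) V
  + map_mx (@complex.Im R) U *m map_mx (@complex.Re R) V.
Proof.
apply/matrixP => i j; rewrite !mxE.
rewrite (raddf_sum (@complex.Im R : Rcomplex R -> R)) -big_split.
by apply: eq_bigr => a _; rewrite !mxE; case: (U i a) (V a j) => [? ?] [? ?].
Qed.

(* The real and imaginary parts of [U F = L U] and [W U = 1], where [U] puts
   [F] in complex triangular form [L]. *)
Lemma hurwitz_triangular_form {R : realType} {n : nat} (F : 'M[R]_n) :
  hurwitz (char_poly F) ->
  exists Ur Ui Lr Li Wr Wi : 'M[R]_n,
    [/\ is_trig_mx Lr, is_trig_mx Li & forall i, Lr i i < 0] /\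
    [/\ Ur *m F = Lr *m Ur - Li *m Ui, Ui *m F = Lr *m Ui + Li *m Ur &
        Wr *m Ur - Wi *m Ui = 1%:M].
Proof.
move=> hF; pose FC := map_mx (real_complex R) F.
have [U Uu Ut] : exists2 U : 'M[R[i]]_n, U \in unitmx & is_trig_mx (U *m FC *m invmx U).
  have [n0|n0] := posnP n.
    exists 1%:M; first exact: unitmx1.
    by apply/is_trig_mxP => i; have := ltn_ord i; rewrite {2}n0.
  have [U Uu] := Schur FC n0.
  have UU := unitarymx_unit Uu.
  by rewrite /similar_to/= conjumx// => Ut; exists U.
pose L := U *m FC *m invmx U.
have LU : L *m U = U *m FC by rewrite /L mulmxKV.
(* The diagonal entries of [L] are eigenvalues of [F]. *)
have Lroot i : complex.Re (L i i) < 0.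
  apply: hF; rewrite map_char_poly.
  have -> : char_poly (map_mx (real_complex R) F) = char_poly L.
    exact: char_poly_similar Uu (esym LU).
  rewrite char_poly_trig// /root horner_prod (bigD1 i)//= !hornerE subrr mul0r//.
pose re := map_mx (@complex.Re R); pose im := map_mx (@complex.Im R).
exists (re _ _ U), (im _ _ U), (re _ _ L), (im _ _ L),
  (re _ _ (invmx U)), (im _ _ (invmx U)).
have reF : re _ _ FC = F by apply/matrixP => i j; rewrite !mxE.
have imF : im _ _ FC = 0 by apply/matrixP => i j; rewrite !mxE.
split; split.
- by apply/is_trig_mxP => i j ij; move/is_trig_mxP : Ut => Ut; rewrite mxE Ut.
- by apply/is_trig_mxP => i j ij; move/is_trig_mxP : Ut => Ut; rewrite mxE Ut.
- by move=> i; rewrite mxE.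
- by rewrite -map_Re_mulmx LU map_Re_mulmx [map_mx _ FC]reF [map_mx _ FC]imF mulmx0 subr0.
- by rewrite -map_Im_mulmx LU map_Im_mulmx
    [map_mx _ FC in X in _ + X]reF [map_mx _ FC]imF mulmx0 add0r.
- rewrite -map_Re_mulmx mulVmx//; apply/matrixP => i j; rewrite !mxE.
  by case: eqP.
Qed.

(** [Ur *m x] and [Ui *m x] solve the triangular system with forcing [Ur *m g], [Ui *m g]; the bound
    found there returns to [x], the real part of [W (U x)]. *)
Lemma hurwitz_bound {R : realType} {n : nat} (F : 'M[R]_n) :
  hurwitz (char_poly F) ->
  exists2 k, 0 <= k & forall b S (x g : R -> 'cV[R]_n) G,
    finite_set S -> 0 <= G ->
    coord_antiderivative_on b S x (fun s => F *m x s + g s) ->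
    (forall s, 0 < s < b -> ~ S s -> `|g s| <= G) ->
    forall s, 0 <= s <= b -> `|x s| <= k * (`|x 0| + G).
Proof.
move=> /hurwitz_triangular_form.
move=> [Ur [Ui [Lr [Li [Wr [Wi [[Lrt Lit Lrn] [UrF UiF WU]]]]]]]].
have [k k0 kP] := triangular_bound Lrt Lit Lrn.
pose e := entry_sum Ur + entry_sum Ui; pose w := entry_sum Wr + entry_sum Wi.
have e0 : 0 <= e by rewrite addr_ge0 ?entry_sum_ge0.
have w0 : 0 <= w by rewrite addr_ge0 ?entry_sum_ge0.
have Ure (x : 'cV[R]_n) (c : R) : `|x| <= c -> `|Ur *m x| <= e * c.
  move=> xc; rewrite (le_trans (norm_mulmx_le _ _))// ler_pM ?entry_sum_ge0//.
  by rewrite lerDl entry_sum_ge0.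
have Uie (x : 'cV[R]_n) (c : R) : `|x| <= c -> `|Ui *m x| <= e * c.
  move=> xc; rewrite (le_trans (norm_mulmx_le _ _))// ler_pM ?entry_sum_ge0//.
  by rewrite lerDr entry_sum_ge0.
exists (w * (k * e)); first by rewrite !mulr_ge0.
move=> b S x g G fS G0 xd gG s sb.
have [||||||pk qk] := kP b S (fun s => Ur *m x s) (fun s => Ui *m x s)
  (fun s => Ur *m g s) (fun s => Ui *m g s) (e * `|x 0|) (e * G) fS _ _ _ _ _ _ s sb.
- by rewrite mulr_ge0.
- apply: eq_coord_antiderivative_on (coord_antiderivative_onMl Ur xd) => t _ _.
  by rewrite mulmxDr !mulmxA -mulmxBl -UrF.
- apply: eq_coord_antiderivative_on (coord_antiderivative_onMl Ui xd) => t _ _.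
  by rewrite mulmxDr !mulmxA -mulmxDl -UiF.
- exact: Ure.
- exact: Uie.
- by move=> t tb tS; split; [apply: Ure|apply: Uie]; exact: gG.
have -> : x s = Wr *m (Ur *m x s) - Wi *m (Ui *m x s).
  by rewrite !mulmxA -mulmxBl WU mul1mx.
rewrite (le_trans (ler_normB _ _))// -mulrA -mulrA mulrDl mulrDr.
by rewrite lerD// (le_trans (norm_mulmx_le _ _))// ler_wpM2l ?entry_sum_ge0// mulrDr.
Qed.

(** * The characteristic polynomial as [alpha] grows *)

(** The difference vanishes at as many positive integers as its size, hence is zero. *)
Lemma poly_eq_on_pos {R : realFieldType} (p q : {poly R}) :
  (forall e, 0 < e -> p.[e] = q.[e]) -> p = q.
Proof.
move=> pq; apply/eqP; rewrite -subr_eq0; apply/eqP.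
apply: (@roots_geq_poly_eq0 _ _ [seq i.+1%:R | i <- iota 0 (size (p - q))]).
- apply/allP => _ /mapP[i _ ->]; rewrite /root !hornerE pq ?subrr// ltr0n//.
- rewrite map_inj_uniq ?iota_uniq// => i j /eqP.
  by rewrite eqr_nat => /eqP[].
- by rewrite size_map size_iota.
Qed.

Lemma horner_char_poly {K : comNzRingType} {n : nat} (A : 'M[K]_n) (s : K) :
  (char_poly A).[s] = \det (s%:M - A).
Proof.
rewrite -[LHS]/(horner_eval s _) -det_map_mx; congr (\det _).
by apply/matrixP => i j; rewrite !mxE/= horner_evalE !hornerE hornerMn hornerX.
Qed.

Definition predictor_feedback {R : realType} {n m : nat} (A : 'M[R]_n)
    (B : 'M[R]_(n, m)) (C : 'M[R]_(m, n)) (T : R) :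
    'M[R]_(m, n) :=
  invmx (pred_gain A B C T) *m (C *m expmx (T *: A)).

(** The plant dynamics under [u = - K x], that is, with predicted output kept at zero. *)
Definition reduced_matrix {R : realType} {n m : nat} (A : 'M[R]_n)
    (B : 'M[R]_(n, m)) (C : 'M[R]_(m, n)) (T : R) : 'M[R]_n :=
  A - B *m predictor_feedback A B C T.

(** The derivative of [K x] adds [K F x + K B v] to [v']. Controllers (b) and (c) cancel it by their
    drift term; (a) keeps it. *)
Definition drift_x {R : realType} {n m : nat} (A : 'M[R]_n)
    (B : 'M[R]_(n, m)) (C : 'M[R]_(m, n)) (T : R) (c : controller) :
    'M[R]_(m, n) :=
  if c is ControllerA then predictor_feedback A B C T *m reduced_matrix A B C T else 0.

Definition drift_v {R : realType} {n m : nat} (A : 'M[R]_n)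
    (B : 'M[R]_(n, m)) (C : 'M[R]_(m, n)) (T : R) (c : controller) :
    'M[R]_m :=
  if c is ControllerA then predictor_feedback A B C T *m B else 0.

(* The system matrix in the coordinates [x] and [v = u + predictor_feedback *m x]. *)
Definition slow_fast_matrix {R : realType} {n m : nat} (A : 'M[R]_n)
    (B : 'M[R]_(n, m)) (C : 'M[R]_(m, n)) (T : R) (c : controller)
    (alpha : R) : 'M[R]_(n + m) :=
  block_mx (reduced_matrix A B C T) B
    (drift_x A B C T c) (drift_v A B C T c - alpha%:M).

Definition slow_fast_change {R : realType} {n m : nat} (A : 'M[R]_n)
    (B : 'M[R]_(n, m)) (C : 'M[R]_(m, n)) (T : R) :
    'M[R]_(n + m) :=
  block_mx 1%:M 0 (predictor_feedback A B C T) 1%:M.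

(** This intertwining serves twice: it equates characteristic polynomials and it transports the
    differential equation. *)
Lemma system_matrix_similar {R : realType} {n m : nat} (A : 'M[R]_n)
    (B : 'M[R]_(n, m)) (C : 'M[R]_(m, n)) (T : R) (c : controller)
    (alpha : R) :
  slow_fast_change A B C T *m system_matrix A B C T c alpha =
  slow_fast_matrix A B C T c alpha *m slow_fast_change A B C T.
Proof.
rewrite /slow_fast_matrix /slow_fast_change /drift_x /drift_v /reduced_matrix.
rewrite /system_matrix /predictor_feedback; set M := invmx _; set E := C *m _.
case: c; rewrite !mulmx_block !(mulmx1, mul1mx, mulmx0, mul0mx, addr0, add0r);
  rewrite subrK; congr block_mx.
all: rewrite ?(mulmxBr, mulmxBl, mulmxDr, mulmxDl, mulNmx, mulmxN).
all: rewrite ?mul_scalar_mx -?scalemxAr ?mulmxA.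
1: by rewrite addrA subrK.
all: by rewrite ?opprD addrCA subrr addr0.
Qed.

Lemma slow_fast_change_unit {R : realType} {n m : nat} (A : 'M[R]_n)
    (B : 'M[R]_(n, m)) (C : 'M[R]_(m, n)) (T : R) :
  slow_fast_change A B C T \in unitmx.
Proof. by rewrite unitmxE det_lblock !det1 mulr1 unitr1. Qed.

(* With [e = 1 / alpha], both sides of the expansion times [e ^+ m] are
   polynomials in [e], to be compared at [e = 0]. *)
Lemma char_poly_reduced_matrix {R : realType} {n m : nat} (A : 'M[R]_n)
    (B : 'M[R]_(n, m)) (C : 'M[R]_(m, n)) (T : R) (c : controller)
    (P : nat -> {poly R}) :
  alpha_expansion (system_matrix A B C T c) P ->
  char_poly (reduced_matrix A B C T) = P 0%N.
Proof.
move=> PE; apply: poly_eq_on_pos => s _.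
(* For [e != 0], [N0 + e *: N1] is [s%:M] minus the slow-fast matrix at [alpha = e^-1], with its
   last [m] rows multiplied by [e]. Here [s] is fixed and [p] is a polynomial in [e]. *)
pose N0 : 'M[R]_(n + m) := block_mx (s%:M - reduced_matrix A B C T) (- B) 0 1%:M.
pose N1 : 'M[R]_(n + m) := block_mx 0 0 
  (- drift_x A B C T c) (s%:M - drift_v A B C T c).
pose p := \det (map_mx polyC N0 + 'X *: map_mx polyC N1).
have pE e : p.[e] = \det (N0 + e *: N1).
  rewrite -[LHS]/(horner_eval e _) -det_map_mx; congr (\det _).
  by apply/matrixP => i j; rewrite !mxE/= horner_evalE !hornerE.
have : p = \sum_(i < m.+1) (P (m - i)%N).[s] *: 'X^(m - i).
  apply: poly_eq_on_pos => e e0; rewrite pE.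
  have e0' : e != 0 by rewrite gt_eqF.
  have -> : N0 + e *: N1 =
      block_mx 1%:M 0 0 e%:M *m (s%:M - slow_fast_matrix A B C T c e^-1).
    rewrite [s%:M]scalar_mx_block opp_block_mx add_block_mx mulmx_block.
    rewrite !(mul1mx, mul0mx, mulmx0, add0r, addr0) !mul_scalar_mx.
    rewrite /N0 /N1 scale_block_mx add_block_mx !(scaler0, addr0, add0r).
    congr block_mx.
    by rewrite [in RHS]opprB addrCA [RHS]scalerDr scale_scalar_mx mulfV.
  rewrite det_mulmx det_lblock det1 mul1r det_scalar -horner_char_poly.
  rewrite -(char_poly_similar (slow_fast_change_unit A B C T)
    (system_matrix_similar A B C T c _)).
  rewrite PE ?invr_gt0// horner_sum horner_sum mulr_sumr.
  apply: eq_bigr => i _; rewrite !hornerZ hornerXn mulrA [RHS]mulrC; congr (_ * _).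
  have im : (i <= m)%N by rewrite -ltnS.
  by rewrite -{1}(subnK im) exprD exprVn mulfK ?expf_neq0.
(* At [e = 0] the matrix is block upper triangular with determinant [\det (s%:M - F)]; in the sum
   only [i = m] survives, giving [P 0]. *)
move=> /(congr1 (fun q => q.[0])); rewrite pE scale0r addr0 det_ublock det1 mulr1.
rewrite -horner_char_poly => ->; rewrite horner_sum big_ord_recr/= subnn big1.
  by rewrite add0r expr0 !hornerE.
by move=> i _; rewrite !hornerE expr0n subn_eq0 leqNgt ltn_ord mulr0.
Qed.

(** * Euclidean, max and essential-supremum norms *)

Lemma entry_le_enorm {R : realType} {k : nat} (v : 'cV[R]_k) i : `|v i 0| <= enorm v.
Proof.
rewrite -sqrtr_sqr ler_wsqrtr// (bigD1 i)//= lerDl.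
by apply: sumr_ge0 => j _; exact: sqr_ge0.
Qed.

Lemma norm_le_enorm {R : realType} {k : nat} (v : 'cV[R]_k) : `|v| <= enorm v.
Proof. by apply: norm_le_entries; [exact: sqrtr_ge0|exact: entry_le_enorm]. Qed.

Lemma enorm_le_norm {R : realType} {k : nat} (v : 'cV[R]_k) :
  enorm v <= k%:R * `|v|.
Proof.
rewrite -[leRHS]ger0_norm ?mulr_ge0 ?ler0n// -sqrtr_sqr ler_wsqrtr//.
apply: (@le_trans _ _ (\sum_(i < k) `|v| ^+ 2)).
  apply: ler_sum => i _; rewrite -[leLHS]real_normK ?num_real//.
  by rewrite ler_sqr ?nnegrE// entry_le_norm.
rewrite sumr_const card_ord exprMn -[leLHS]mulr_natl ler_wpM2r ?sqr_ge0//.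
by rewrite -natrX ler_nat; case: (k) => // j; rewrite leq_pmulr.
Qed.

(** If a coordinate exceeded [L] in absolute value at [t], by continuity it would do so on an
    interval around [t], which cannot lie in a null set. *)
Lemma norm_le_Linfty {R : realType} {k : nat} (f : R -> 'cV[R]_k) (t L : R) :
  Linfty_norm f = L%:E -> 0 < t -> {for t, continuous f} -> `|f t| <= L.
Proof.
move=> fL; have L0 : 0 <= L by rewrite -lee_fin -fL; exact: Lnorm_ge0.
(* At exponent [+oo] the norm unfolds to an essential supremum because the line has positive
   measure. *)
move: fL; rewrite /Linfty_norm unlock/= -set_itvNyy lebesgue_measure_itv/= lt0y.
set g := (X in ess_sup _ X) => gL t0 fc.
apply: norm_le_entries => // i; rewrite leNgt; apply/negP => Lf.
have : \forall x \ae lebesgue_measure, (g x <= L%:E)%E.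
  by rewrite -gL; exact: ess_sup_ge.
move=> [N [mN N0 gN]].
have [e e0 eN] : exists2 e : R, 0 < e & `]t - e, t + e[ `<=` N.
  have fci : f x i 0 @[x --> t] --> f t i 0.
    exact: (@cvg_comp _ _ _ f (fun M : 'cV[R]_k => M i 0) _ _ _ fc
      (@coord_continuous _ _ _ i 0 (f t))).
  (* Positivity keeps [x] in the half-line, where the extension by 0 leaves the function
     unchanged. *)
  have /nbhs_ballP[e /= e0 be] : \forall x \near t, 0 < x /\ L < `|f x i 0|.
    near=> x; split.
      by near: x; exact: lt_nbhsr.
    by near: x; exact: cvgr_gt (cvg_norm fci) _ Lf.
  exists e => // x; rewrite /= in_itv/= => xt.
  apply: gN => /=; rewrite /g/= patchE.
  have [] := be x _; first by rewrite /ball/= distrC ltr_distl.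
  move=> x0 Lx.
  have -> : x \in `[0, +oo[%classic by rewrite mem_set//= in_itv/= andbT ltW.
  rewrite abse_EFin lee_fin.
  apply/negP; rewrite -ltNge ger0_norm ?sqrtr_ge0// (lt_le_trans Lx)//.
  exact: entry_le_enorm.
have := le_measure lebesgue_measure _ _ eN.
rewrite !inE => /(_ (measurable_itv _) mN).
rewrite /= N0 lebesgue_measure_itv/= lte_fin ltrD2l gtrN// -EFinB lee_fin.
by rewrite leNgt (_ : 0 < _)//; lra.
Unshelve. all: by end_near. Qed.

(** * Small-gain estimate for the slow-fast system *)

Lemma within_continuous_sum {R : realType} {k : nat} (A : set R) (h : 'I_k -> R -> R) :
  (forall i, {within A, continuous (h i)}) ->
  {within A, continuous (fun s => \sum_i h i s)}.
Proof.
move=> hc; rewrite -fct_sumE; elim/big_ind : _ => //.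
- by move=> s; exact: cvg_cst.
- by move=> f g fc gc; exact: within_continuousD.
Qed.

(* Small gain: the supremum [V] of the fast variable over [0, b] is bounded by
   the data plus a multiple [O(1 / alpha)] of itself. *)
Lemma slow_fast_bound {R : realType} {n m : nat} (F : 'M[R]_n) (B : 'M[R]_(n, m))
    (D : 'M[R]_(m, n)) (E : 'M[R]_m) :
  hurwitz (char_poly F) ->
  exists k alpha0, [/\ 0 <= k, 1 <= alpha0 & forall alpha b S
      (x : R -> 'cV[R]_n) (v w : R -> 'cV[R]_m) H,
    alpha0 <= alpha -> 0 <= b -> finite_set S -> 0 <= H ->
    coord_antiderivative_on b S x (fun s => F *m x s + B *m v s) ->
    coord_antiderivative_on b S v
      (fun s => D *m x s + E *m v s - alpha *: v s + w s) ->
    (forall s, 0 < s < b -> ~ S s -> `|w s| <= alpha * H) ->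
    `|x b| + `|v b| <= k * (`|x 0| + `|v 0| + H)].
Proof.
move=> /hurwitz_bound[k k0 kP].
pose dB := entry_sum B; pose dD := entry_sum D; pose dE := entry_sum E.
have dB0 : 0 <= dB by exact: entry_sum_ge0.
have dD0 : 0 <= dD by exact: entry_sum_ge0.
have dE0 : 0 <= dE by exact: entry_sum_ge0.
(* Gains into the coupling [D x + E v] from the initial slow state ([p]) and from [V] ([q]). *)
pose p := dD * k; pose q := p * dB + dE.
have p0 : 0 <= p by rewrite mulr_ge0.
have q0 : 0 <= q by rewrite addr_ge0// mulr_ge0.
(* Once [alpha >= 4 * m%:R * q], the feedback of [V] into itself has factor at most one half. *)
exists (k + (k * dB + 1) * (4 * m%:R * (1 + p))), (1 + 4 * m%:R * q).
split; first by rewrite !(addr_ge0, mulr_ge0).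
  by rewrite lerDl !mulr_ge0.
move=> alpha b S x v w H ale b0 fS H0 xd vd wH.
have al1 : 1 <= alpha by rewrite (le_trans _ ale)// lerDl !mulr_ge0.
have al0 : 0 < alpha by rewrite (lt_le_trans _ al1).
(* The sum of absolute values dominates the max norm and, being continuous, attains its maximum [V]
   on [[0, b]]. *)
pose f s := \sum_i `|v s i 0|.
have vf s : `|v s| <= f s.
  apply: norm_le_entries => [|i]; first exact: sumr_ge0.
  by rewrite /f (bigD1 i)//= lerDl sumr_ge0.
have [s0 s0b fmax] : exists2 c, c \in `[0, b]%R & forall t, t \in `[0, b]%R -> f t <= f c.
  apply: EVT_max => //; apply: within_continuous_sum => i s.
  by apply: cvg_norm; exact: (vd i).1.
rewrite in_itv/= in s0b; set V := f s0 in fmax.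
have V0 : 0 <= V by exact: sumr_ge0.
have vV s : 0 <= s <= b -> `|v s| <= V.
  by move=> sb; rewrite (le_trans (vf s))// fmax// in_itv.
pose X := k * (`|x 0| + dB * V).
have xX s : 0 <= s <= b -> `|x s| <= X.
  apply: (kP b S x (fun s => B *m v s) (dB * V) fS) => // [|t /andP[t0 tb] _].
    by rewrite mulr_ge0.
  by rewrite (le_trans (norm_mulmx_le _ _))// ler_wpM2l// vV// !ltW.
have X0 : 0 <= X by rewrite mulr_ge0// addr_ge0// mulr_ge0.
pose G := dD * X + dE * V + alpha * H.
have G0 : 0 <= G by rewrite !(addr_ge0, mulr_ge0)// ltW.
(* Each coordinate of [v] is damped at rate [alpha]: the rotation bound applies with [om = 0] and a
   zero second component. *)
have vG i : `|v s0 i 0| <= 2 * (`|v 0| + G / alpha).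
  have [|||||//] := @damped_rotation_bound _ b alpha 0 `|v 0| G S
    (fun s => v s i 0) (fun=> 0)
    (fun s => (D *m x s + E *m v s + w s) i 0) (fun=> 0) fS al0 G0 _ _ _ _ _ s0 s0b.
  - apply: eq_antiderivative_on (vd i) => // s _ _.
    by rewrite !mxE; ring.
  - apply: eq_antiderivative_on (antiderivative_on_cst b S 0) => // s _ _; ring.
  - exact: entry_le_norm.
  - by rewrite normr0.
  - move=> s sb sS; rewrite normr0; split=> //.
    have sb' : 0 <= s <= b by case/andP: sb => *; rewrite !ltW.
    rewrite (le_trans (entry_le_norm _ _ _))// (le_trans (ler_normD _ _))//.
    rewrite lerD ?wH// (le_trans (ler_normD _ _))// lerD//;
      by rewrite (le_trans (norm_mulmx_le _ _))// ler_wpM2l// ?xX ?vV.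
have VG : V <= m%:R * (2 * (`|v 0| + G / alpha)).
  rewrite mulr_natl -[X in _ *+ X]card_ord -sumr_const.
  by apply: ler_sum => j _; exact: vG.
have V4 : V <= 4 * m%:R * (`|v 0| + H + p * `|x 0|).
  have alE : alpha * (G / alpha) = p * `|x 0| + q * V + alpha * H.
    by rewrite mulrCA mulfV ?gt_eqF// mulr1 /G /X /q /p; ring.
  (* This absorbs the [q * V] term into the left side, turning the factor 2 into 4. *)
  have qV : 4 * m%:R * (q * V) <= alpha * V.
    by rewrite mulrA ler_wpM2r// (le_trans _ ale)// lerDr.
  rewrite -(ler_pM2l al0).
  have : alpha * V <= 2 * m%:R * (alpha * `|v 0| + alpha * (G / alpha)).
    have -> : 2 * m%:R * (alpha * `|v 0| + alpha * (G / alpha)) =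
      alpha * (m%:R * (2 * (`|v 0| + G / alpha))) by ring.
    by rewrite ler_pM2l.
  rewrite alE.
  have : m%:R * (p * `|x 0|) <= alpha * (m%:R * (p * `|x 0|)).
    by rewrite ler_peMl// !mulr_ge0.
  nra.
have := xX b; have := vV b; rewrite b0 lexx => /(_ isT) vb /(_ isT) xb.
apply: le_trans (lerD xb vb) _.
rewrite /X.
have -> : k * (`|x 0| + dB * V) + V = k * `|x 0| + (k * dB + 1) * V by ring.
rewrite [leRHS]mulrDl lerD//.
  by rewrite ler_wpM2l// -addrA lerDl addr_ge0.
rewrite -mulrA ler_wpM2l ?addr_ge0 ?mulr_ge0//.
rewrite (le_trans V4)// -[leRHS]mulrA ler_wpM2l ?mulr_ge0//.
have := normr_ge0 (x 0); have := normr_ge0 (v 0) => v0 x0.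
by have := mulr_ge0 p0 v0; have := mulr_ge0 p0 H0; nra.
Qed.

(** * The closed loop in slow-fast coordinates and its input *)

Lemma sub_coord_antiderivative_on {R : realType} {k : nat} (b : R) (S S' : set R)
    (x dx : R -> 'cV[R]_k) :
  S `<=` S' -> coord_antiderivative_on b S x dx -> coord_antiderivative_on b S' x dx.
Proof.
move=> SS' xd i; have [xc {}xd] := xd i; split=> // s sb sS'.
by apply: xd => // /SS'.
Qed.

Lemma coord_antiderivative_onP {R : realType} {k : nat} (b : R) (S : set R)
    (x dx : R -> 'cV[R]_k) :
  {within `[0, +oo[, continuous x} ->
  (forall t, 0 < t -> ~ S t -> is_derive t 1 x (dx t)) ->
  coord_antiderivative_on b (S `&` `[0, b]) x dx.
Proof.
move=> xc xd i; split.
  have {}xc : {within `[0, b], continuous x}.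
    by apply: continuous_subspaceW xc; apply: subset_itvl.
  move=> s; exact: (@cvg_comp _ _ _ x (fun M : 'cV[R]_k => M i 0) _ _ _ (xc s)
    (@coord_continuous _ _ _ i 0 (x s))).
move=> s /andP[s0 sb] Ss.
have [|xs <-] := xd s s0.
  by move=> S1; apply: Ss; split=> //=; rewrite in_itv/= !ltW.
rewrite derive_mx// mxE; apply/derivableP.
exact: (derivable_mxP x s 1).1.
Qed.

(** The change of coordinates is applied to the affine form of the loop. It fixes vectors
    [col_mx 0 w], so the input enters only the equation of [v]. *)
Lemma closed_loop_slow_fast {R : realType} {n m : nat} (A : 'M[R]_n)
    (B : 'M[R]_(n, m)) (C : 'M[R]_(m, n)) (T : R) (c : controller)
    (alpha b : R) (r u : R -> 'cV[R]_m) (x : R -> 'cV[R]_n) :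
  pred_gain A B C T \in unitmx ->
  closed_loop_trajectory A B C T c alpha r x u ->
  let v t := u t + predictor_feedback A B C T *m x t in
  exists S, [/\ finite_set S,
    coord_antiderivative_on b S x
      (fun s => reduced_matrix A B C T *m x s + B *m v s) &
    coord_antiderivative_on b S v
      (fun s => drift_x A B C T c *m x s + drift_v A B C T c *m v s - alpha *: v s
        + controller_input A B C T c alpha (r (s + T)) (derive1 r (s + T)))].
Proof.
set K := predictor_feedback A B C T.
move=> hM [xc uc [S [Sfin xu]]] v; exists (S `&` `[0, b]); split; first exact: Sfin.
  have := @coord_antiderivative_onP _ _ b _ _ _ xc (fun t t0 St => (xu t t0 St).1).
  apply: eq_coord_antiderivative_on => s _ _.
  rewrite /v /reduced_matrix mulmxBl mulmxDr mulmxA.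
  by rewrite [B *m u s + _]addrC addrA subrK.
have xd := @coord_antiderivative_onP _ _ b _ _ _ xc (fun t t0 St => (xu t t0 St).1).
have ud := @coord_antiderivative_onP _ _ b _ _ _ uc (fun t t0 St => (xu t t0 St).2).
have := coord_antiderivative_onD ud (coord_antiderivative_onMl K xd).
apply: eq_coord_antiderivative_on => s _ _.
have := congr1 (fun z => slow_fast_change A B C T *m z)
  (closed_loop_affine c alpha (x s) (u s) (r (s + T)) (derive1 r (s + T)) hM).
rewrite mulmxDr mulmxA system_matrix_similar -mulmxA !mul_block_col.
rewrite !(mul1mx, mul0mx, mulmx0, addr0, add0r) add_col_mx => /eq_col_mx[_].
by rewrite [in LHS]addrC => ->; rewrite [K *m x s + _]addrC mulmxBl mul_scalar_mx addrA.
Qed.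

(** The essential bound on [r'] is used at its continuity points, hence the exceptional set. As
    [alpha >= 1], the term [L2] is also at most [alpha * L2]. *)
Lemma controller_input_bound {R : realType} {n m : nat} (A : 'M[R]_n)
    (B : 'M[R]_(n, m)) (C : 'M[R]_(m, n)) (T : R) (c : controller)
    (alpha b L1 L2 : R) (r : R -> 'cV[R]_m) :
  0 < T -> 1 <= alpha -> admissible_input r ->
  Linfty_norm r = L1%:E -> Linfty_norm (derive1 r) = L2%:E ->
  exists2 S, finite_set S & forall s, 0 < s < b -> ~ S s ->
    `|controller_input A B C T c alpha (r (s + T)) (derive1 r (s + T))| <=
    alpha * (entry_sum (invmx (pred_gain A B C T)) * (L1 + L2)).
Proof.
move=> T0 al1 [rc [S [Sfin rd _ _]]] r1 r2.
(* The input is read at [s + T], so the breakpoints of [r] are shifted back by [T]. *)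
exists ((fun t => t - T) @` (S `&` `[0, b + T])).
  exact/finite_image/Sfin.
move=> s /andP[s0 sb] Ss.
have sT : 0 < s + T by rewrite addr_gt0.
have al0 : 0 <= alpha by exact: le_trans al1.
have L20 : 0 <= L2 by rewrite -lee_fin -r2; exact: Lnorm_ge0.
have dr : `|derive1 r (s + T)| <= L2.
  apply: (norm_le_Linfty r2 sT); apply: (rd _ sT _).2 => SsT; apply: Ss.
  exists (s + T); last by rewrite addrK.
  by split=> //=; rewrite in_itv/= ltW// lerD2r ltW.
have rr : `|r (s + T)| <= L1.
  apply: (norm_le_Linfty r1 sT).
  apply: (@within_continuous_continuous _ _ _ 0 (s + T + 1)).
  - by rewrite addr_gt0// ltr01.
  - by apply: continuous_subspaceW rc; exact: subset_itvl.
  - by rewrite in_itv/= sT ltrDl ltr01.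
rewrite mulrCA (le_trans (norm_mulmx_le _ _))// ler_wpM2l ?entry_sum_ge0//.
rewrite (le_trans (ler_normD _ _))// mulrDr lerD//.
  by rewrite normrZ ger0_norm// ler_wpM2l.
apply: (@le_trans _ _ L2); last by rewrite ler_peMl.
by case: c; rewrite ?normr0.
Qed.

(** * Linear gains and conclusion *)

Lemma class_K_linear {R : realType} (k : R) : 0 < k -> class_K (fun s => k * s).
Proof.
move=> k0; split; first exact: mulr0.
  apply: continuous_subspaceT => s; exact: mulrl_continuous.
by move=> s t _ _ st; rewrite ltr_pM2l.
Qed.

Theorem theorem4p5 (R : realType) (n m : nat) (A : 'M[R]_n)
    (B : 'M[R]_(n, m)) (C : 'M[R]_(m, n)) (T : R) (c : controller)
    (P : nat -> {poly R}) (Gamma : set 'cV[R]_(n + m))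
    (hA : A \in unitmx) (hT : 0 < T) (hM : pred_gain A B C T \in unitmx)
    (hP : alpha_expansion (system_matrix A B C T c) P)
    (hsize : forall i : nat, (i <= m)%N -> (size (P i) <= (n + i).+1)%N)
    (hlead : forall i : nat, (i <= m)%N -> (P i)`_(n + i) != 0)
    (hmonic : (P m)`_(n + m) = 1)
    (hGamma : compact Gamma)
    (hP0 : hurwitz (P 0%N)) (hQ : hurwitz (Qpoly n m P)) :
  alpha_stable A B C T c Gamma.
Proof.
rewrite -(char_poly_reduced_matrix hP) in hP0.
have [k [alpha0 [k0 al01 kP]]] :=
  slow_fast_bound B (drift_x A B C T c) (drift_v A B C T c) hP0.
pose K := predictor_feedback A B C T; pose d := entry_sum K.
have d0 : 0 <= d by exact: entry_sum_ge0.
pose mu := entry_sum (invmx (pred_gain A B C T)).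
have mu0 : 0 <= mu by exact: entry_sum_ge0.
(* The factors account for passing from Euclidean to max norm, for returning from [v] to [u], and
   for the slow-fast gain. *)
pose N : R := (n + m)%:R * (1 + d) * k.
have N0 : 0 <= N by rewrite !mulr_ge0// addr_ge0.
exists alpha0; split; first exact: le_trans al01.
(* Adding 1 keeps the slopes positive, hence the functions strictly increasing, even if [N] or [mu]
   is zero. *)
exists (fun s => (N * (2 + d) + 1) * s), (fun s => (N * mu + 1) * s),
  (fun s => (N * mu + 1) * s).
have posD1 (y : R) : 0 <= y -> 0 < y + 1 by move=> y0; rewrite ltr_wpDl.
split; [|by apply/class_K_linear/posD1; rewrite ?mulr_ge0 ?addr_ge0..|].
  by apply/class_K_linear/posD1; rewrite mulr_ge0 ?addr_ge0.
move=> r alpha x u z radm _ al0 traj _ t t0.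
have Linf_ge0 (f : R -> 'cV[R]_m) : (0 <= Linfty_norm f)%E by exact: Lnorm_ge0.
(* An infinite input norm makes the right-hand side [+oo]; afterwards both norms are reals [L1] and
   [L2]. *)
case r1 : (Linfty_norm r) (Linf_ge0 r) => [L1| |]//= L10; last first.
  by case: (Linfty_norm (derive1 r)) (Linf_ge0 (derive1 r)) => [L2| |]//= _;
    rewrite [X in (X + _)%E]addey// addye// leey.
case r2 : (Linfty_norm (derive1 r)) (Linf_ge0 (derive1 r)) => [L2| |]//= L20; last first.
  by rewrite ?addey// ?addye// leey.
rewrite lee_fin in L10; rewrite lee_fin in L20.
have al1 : 1 <= alpha by exact: le_trans al01 al0.
have [S [fS xd vd]] := closed_loop_slow_fast t hM traj.
have [S' fS' inp] := controller_input_bound A B C c t hT al1 radm r1 r2.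
pose v s := u s + K *m x s.
have sub := kP alpha t (S `|` S') x v _ (mu * (L1 + L2)) al0 t0.
have {kP}xv : `|x t| + `|v t| <= k * (`|x 0| + `|v 0| + mu * (L1 + L2)).
  apply: sub.
  - by rewrite finite_setU.
  - by rewrite mulr_ge0// addr_ge0.
  - exact: sub_coord_antiderivative_on xd.
  - exact: sub_coord_antiderivative_on vd.
  - by move=> s st SS; apply: inp => // Ss; apply: SS; right.
have zx s : `|x s| <= `|z s|.
  apply: norm_le_entries => // i.
  by rewrite (le_trans _ (entry_le_norm (z s) (lshift m i) 0))// col_mxEu.
have zu s : `|u s| <= `|z s|.
  apply: norm_le_entries => // i.
  by rewrite (le_trans _ (entry_le_norm (z s) (rshift n i) 0))// col_mxEd.
have Kx s : `|K *m x s| <= d * `|x s| by exact: norm_mulmx_le.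
have zt : `|z t| <= (1 + d) * (`|x t| + `|v t|).
  have ut : `|u t| <= `|v t| + d * `|x t|.
    have -> : u t = v t - K *m x t by rewrite addrK.
    by rewrite (le_trans (ler_normB _ _))// lerD.
  have := normr_ge0 (x t); have := normr_ge0 (v t) => vt0 xt0.
  have dv := mulr_ge0 d0 vt0; have dx := mulr_ge0 d0 xt0.
  apply: norm_le_entries => [|i]; first by rewrite mulr_ge0 ?addr_ge0.
  case: (split_ordP i) => j ->; rewrite ?col_mxEu ?col_mxEd.
    by apply: le_trans (entry_le_norm _ _ _) _; nra.
  by apply: le_trans (entry_le_norm _ _ _) _; nra.
(* In [2 + d], the 2 counts [x 0] and [u 0], and [d] comes from [K *m x 0] inside [v 0]. *)
have xv0 : `|x 0| + `|v 0| <= (2 + d) * enorm (z 0).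
  have z0 := norm_le_enorm (z 0).
  have v0 : `|v 0| <= `|u 0| + d * `|x 0| by rewrite (le_trans (ler_normD _ _))// lerD.
  have := zx 0; have := zu 0 => uz xz.
  have dz : d * `|x 0| <= d * enorm (z 0) by rewrite ler_wpM2l// (le_trans xz).
  by nra.
rewrite -!EFinD lee_fin.
apply: le_trans (enorm_le_norm _) _.
have nm0 : 0 <= (n + m)%:R :> R by exact: ler0n.
apply: (@le_trans _ _ (N * ((2 + d) * enorm (z 0) + mu * (L1 + L2)))).
  rewrite /N -!mulrA ler_wpM2l// (le_trans zt)// ler_wpM2l ?addr_ge0//.
  by rewrite (le_trans xv)// ler_wpM2l// lerD2r.
have e0 : 0 <= enorm (z 0) by exact: sqrtr_ge0.
have -> : N * ((2 + d) * enorm (z 0) + mu * (L1 + L2)) =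
  N * (2 + d) * enorm (z 0) + N * mu * L1 + N * mu * L2 by ring.
by rewrite !lerD// mulrDl mul1r lerDl.
Qed.
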